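(* Let $d\ge 2$, let $(\mathbb{R}^d,\|\cdot\|)$ be a $d$-dimensional Minkowski space, let $T=\mathrm{conv}\{A_0,\ldots,A_d\}$ be a $d$-simplex with a circumcenter $M$ and circumradius $R$, and let $G\ (\neq M)$ be its centroid. Let $N_M$ be the Monge point of $T$ associated to $M$. The sphere $S(F_M,r)$ with center $$F_M:=M+\frac{\sum_{i=0}^{d}(A_i-M)}{d},$$ which lies on the Euler line $\langle MG\rangle$, and of radius $r:=\frac{R}{d}$ passes through the following $2(d+1)$ points: (a) the centroids $G_i$, $i=0,\ldots,d$, of the facets $F_i$ of $T$ ($F_i$ is opposite the vertex $A_i$), and (b) the points $L_i^M$ dividing the segments $[N_MA_i]$ connecting the Monge point $N_M$ to the vertices $A_i$ of $T$, $i=0,\ldots,d$, in the ratio $1:(d-1)$. Moreover, $S(F_M,r)$ is the homothet of the circumsphere $S(M,R)$ with respect to the homothety center $G$ and homothety ratio $\frac{-1}{d}$, i.e. $G$ divides the segment $[F_MM]$ internally in the ratio $1:d$; and $F_M$ divides the segment $[N_MM]$ internally in the ratio $1:(d-1)$.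
   Context: A Minkowski space $(\mathbb{R}^d,\|\cdot\|)$ is $\mathbb{R}^d$ with an arbitrary norm; $S(X,r)=\{Y:\|Y-X\|=r\}$. A $d$-simplex is the convex hull of $d+1$ affinely independent points. $M$ is a circumcenter of $T$ with circumradius $R>0$ if $\|A_i-M\|=R$ for all $i$. The centroid of $T$ (or of a face of $T$) is the arithmetic mean of its vertices. $\langle XY\rangle$ is the line through distinct points $X,Y$ and $[XY]$ is the closed segment. If $M\ne G$, the Euler line associated to $M$ is $\langle MG\rangle$. A point $X$ divides the segment $[AB]$ (internally) in the ratio $p:q$ ($p,q\ge 0$, $p+q>0$) if $X=A+\frac{p}{p+q}(B-A)$ (the ratio is measured starting from the first-named endpoint $A$). The count $2(d+1)$ refers to the indexed points $G_0,\dots,G_d,L_0^M,\dots,L_d^M$. Monge point: for each ridge ($(d-2)$-face) $F$ of $T$ with opposite edge $E_F$ (the segment joining the two vertices not in $F$), if $M$ is not the midpoint of $E_F$, the associated Monge line is the line through the centroid of $F$ parallel to the line through $M$ and the midpoint of $E_F$. The Monge lines have exactly one common point, called the Monge point $N_M$. *)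

(* Defs.v *)
From mathcomp Require Import all_boot all_order all_algebra.
From mathcomp Require Import classical_sets reals.

Set Implicit Arguments.
Unset Strict Implicit.
Unset Printing Implicit Defensive.

Import Order.TTheory GRing.Theory Num.Theory.
Local Open Scope classical_set_scope.
Local Open Scope ring_scope.

(* R^d is the space of row vectors 'rV[R]_d; its norm is an arbitrary function
   nrm satisfying the norm axioms, unrelated to the max norm that `|x| denotes
   on matrices. *)
Definition is_norm (R : realType) (d : nat) (nrm : 'rV[R]_d -> R) : Prop :=
  [/\ forall x y, nrm (x + y) <= nrm x + nrm y,
      forall (a : R) x, nrm (a *: x) = `|a| * nrm x,
      forall x, 0 <= nrm x
    & forall x, nrm x = 0 -> x = 0].

Definition sphere (R : realType) (d : nat) (nrm : 'rV[R]_d -> R)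
    (X : 'rV[R]_d) (r : R) : set 'rV[R]_d :=
  [set Y | nrm (Y - X) = r].

Definition affinely_independent (R : realType) (d n : nat)
    (A : 'I_n -> 'rV[R]_d) : Prop :=
  forall c : 'I_n -> R,
    \sum_(i < n) c i = 0 -> \sum_(i < n) c i *: A i = 0 -> forall i, c i = 0.

(* A d-simplex is given by its vertices A : 'I_d.+1 -> 'rV[R]_d, and a face by
   the set P of the indices of its vertices; centroid A P is the arithmetic
   mean of these vertices.  The facet opposite A i is predC1 i, and the ridge
   opposite the edge [A i, A j] is predC (pred2 i j). *)
Definition centroid (R : realType) (d n : nat) (A : 'I_n -> 'rV[R]_d)
    (P : {pred 'I_n}) : 'rV[R]_d :=
  (#|P|%:R)^-1 *: \sum_(i in P) A i.

Definition is_circumcenter (R : realType) (d n : nat) (nrm : 'rV[R]_d -> R)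
    (A : 'I_n -> 'rV[R]_d) (M : 'rV[R]_d) (rho : R) : Prop :=
  0 < rho /\ forall i, nrm (A i - M) = rho.

Definition midpoint (R : realType) (d : nat) (X Y : 'rV[R]_d) : 'rV[R]_d :=
  2^-1 *: (X + Y).

(* The line through P parallel to the line XY, for X != Y. *)
Definition parallel_line (R : realType) (d : nat) (P X Y : 'rV[R]_d) :
    set 'rV[R]_d :=
  [set Z | exists t : R, Z = P + t *: (Y - X)].

(* The line XY, for X != Y. *)
Definition line (R : realType) (d : nat) (X Y : 'rV[R]_d) : set 'rV[R]_d :=
  parallel_line X X Y.

Definition monge_line (R : realType) (d n : nat) (A : 'I_n -> 'rV[R]_d)
    (M : 'rV[R]_d) (i j : 'I_n) : set 'rV[R]_d :=
  parallel_line (centroid A (predC (pred2 i j))) M (midpoint (A i) (A j)).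

(* The ridges are enumerated by their opposite edges.  N is a common point of
   all the Monge lines; that there is no other one is not part of the
   definition. *)
Definition is_monge_point (R : realType) (d n : nat) (A : 'I_n -> 'rV[R]_d)
    (M N : 'rV[R]_d) : Prop :=
  forall i j : 'I_n, i != j -> M != midpoint (A i) (A j) ->
    monge_line A M i j N.

(* The point dividing the segment [XY] in the ratio p : q, measured from X;
   the division is internal when 0 <= p, 0 <= q and 0 < p + q. *)
Definition dividing_point (R : realType) (d : nat) (X Y : 'rV[R]_d) (p q : R) :
    'rV[R]_d :=
  X + (p / (p + q)) *: (Y - X).

Definition homothety (R : realType) (d : nat) (C : 'rV[R]_d) (k : R)
    (X : 'rV[R]_d) : 'rV[R]_d :=
  C + k *: (X - C).

(* Main.v *)
Require Import Defs.
From mathcomp Require Import all_boot all_order all_algebra.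
From mathcomp Require Import classical_sets reals.
From mathcomp Require Import ring.
Import Order.TTheory GRing.Theory Num.Theory.
Local Open Scope classical_set_scope.
Local Open Scope ring_scope.
Set Implicit Arguments.
Unset Strict Implicit.

(** Measure every point from the circumcenter: put a_i = A_i - M and let S be
    the sum of the a_i.  The points in play are then
      G = M + S / (d+1),  F = M + S / d,  N = M + S / (d-1),
    all on one line through M, and the ratios in which they divide each other
    are read off from the three coefficients.  Moreover G_i - F = - a_i / d and
    L_i - F = a_i / d, so each of these points is at distance rho / d from F,
    because every a_i has norm rho.  The homothety with center G and ratio
    -1/d sends M to F and multiplies distances by 1/d, so it carries the
    circumsphere onto S(F, rho/d).

    The formula for N is the only step with geometric content
    ([monge_point_unique]).  The Monge line of the edge [A_i A_j] passes through
    M + (S - a_i - a_j) / (d-1) in the direction a_i + a_j, so it contains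
    M + S / (d-1).  If N were another common point, the nonzero vector
    v = N - (M + S / (d-1)) would be parallel to every a_i + a_j.  The identity
    2 a_i = (a_i + a_j) + (a_i + a_k) - (a_j + a_k) then makes every a_i parallel
    to v, and three vertices lie on one line through M: this is impossible by
    affine independence ([affinely_independent_not_collinear]). *)

Section Centroids.
Variables (R : realType) (d n : nat).
Implicit Types (A : 'I_n -> 'rV[R]_d) (M : 'rV[R]_d).

(** The mean commutes with translations; this is where nonemptiness of the face
    matters, since the empty face has the junk centroid 0. *)
Lemma centroid_shift A M (P : {pred 'I_n}) : (0 < #|P|)%N ->
  centroid A P = M + #|P|%:R^-1 *: \sum_(i in P) (A i - M).
Proof.
move=> P_gt0; have P_neq0 : #|P|%:R != 0 :> R by rewrite pnatr_eq0 -lt0n.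
rewrite /centroid big_split /= sumr_const -scaler_nat.
by rewrite scalerDr scalerA mulVf // scale1r addrCA subrr addr0.
Qed.

Lemma centroid_simplex A M : (0 < n)%N ->
  centroid A predT = M + n%:R^-1 *: \sum_i (A i - M).
Proof.
by move=> n_gt0; rewrite (centroid_shift A M) ?card_ord.
Qed.

Lemma centroid_facet A M i : (1 < n)%N ->
  centroid A (predC1 i) =
    M + n.-1%:R^-1 *: (\sum_k (A k - M) - (A i - M)).
Proof.
move=> n_gt1; have cardP : #|predC1 i| = n.-1 by rewrite cardC1 card_ord.
rewrite (centroid_shift A M) cardP -?subn1 ?subn_gt0 //.
by rewrite [in RHS](bigD1 i) //= [A i - M + _]addrC addrK.
Qed.

Lemma centroid_ridge A M (i j : 'I_n) : (2 < n)%N -> i != j ->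
  centroid A (predC (pred2 i j)) =
    M + (n - 2)%:R^-1 *: (\sum_k (A k - M) - ((A i - M) + (A j - M))).
Proof.
move=> n_gt2 neq_ij.
have cardP : #|predC (pred2 i j)| = (n - 2)%N.
  by rewrite -[n in RHS]card_ord -(cardC (pred2 i j)) card2 neq_ij addKn.
rewrite (centroid_shift A M) cardP ?subn_gt0 //.
rewrite [in RHS](bigD1 i) //= [in RHS](bigD1 j) /=; last by rewrite eq_sym.
rewrite [X in X - (_ + _)]addrA [X in X - (_ + _)]addrC addrK.
by congr (_ + _ *: _); apply: eq_bigl => k; rewrite !inE negb_or.
Qed.

End Centroids.

Section AffineIndependence.
Variables (R : realType) (d n : nat) (A : 'I_n -> 'rV[R]_d).
Hypothesis indepA : affinely_independent A.

Lemma affinely_independent3 (i j k : 'I_n) (x y z : R) : uniq [:: i; j; k] ->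
  x + y + z = 0 -> x *: A i + y *: A j + z *: A k = 0 -> z = 0.
Proof.
move=> /=; rewrite !inE negb_or => /and3P[/andP[ij ik] jk _] xyz0 sum0.
have sum3 (V : lmodType R) (B : 'I_n -> V) :
    \sum_l ((l == i)%:R * x + (l == j)%:R * y + (l == k)%:R * z) *: B l =
    x *: B i + y *: B j + z *: B k.
  have sum1 m (t : R) : \sum_l ((l == m)%:R * t) *: B l = t *: B m.
    rewrite (bigD1 m) //= eqxx mul1r big1 ?addr0 // => l /negbTE->.
    by rewrite mul0r scale0r.
  under eq_bigr do rewrite !scalerDl.
  by rewrite !big_split /= !sum1.
have:= @indepA (fun l => (l == i)%:R * x + (l == j)%:R * y + (l == k)%:R * z).
rewrite sum3 sum0 => /(_ _ erefl k).
rewrite eqxx (eq_sym k i) (eq_sym k j) (negbTE ik) (negbTE jk).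
rewrite !mul0r !add0r mul1r; apply.
have:= sum3 R^o (fun=> 1); rewrite -!scalerDl xyz0 scale0r => sum0'.
rewrite -[RHS]sum0'; by apply: eq_bigr => l _; rewrite /GRing.scale /= mulr1.
Qed.

(** Points M + s_i v satisfy the affine relation with coefficients
    s_j - s_k, s_k - s_i, s_i - s_j.  Independence forces s_i = s_j, hence
    A_i = A_j, which is again an affine relation. *)
Lemma affinely_independent_not_collinear (i j k : 'I_n) (M v : 'rV[R]_d) (si sj sk : R) :
  uniq [:: i; j; k] ->
  A i - M = si *: v -> A j - M = sj *: v -> A k - M = sk *: v -> False.
Proof.
move=> ijk Ei Ej Ek.
have EAi : A i = M + si *: v by rewrite -Ei addrC subrK.
have EAj : A j = M + sj *: v by rewrite -Ej addrC subrK.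
have EAk : A k = M + sk *: v by rewrite -Ek addrC subrK.
have sij : si - sj = 0.
  apply: (@affinely_independent3 i j k (sj - sk) (sk - si)) => //; first by ring.
  by rewrite EAi EAj EAk; apply/rowP => l; rewrite !mxE; ring.
have kij : uniq [:: k; i; j].
  by rewrite -(rot_uniq 1) /=.
have /eqP : (-1 : R) = 0.
  apply: (@affinely_independent3 k i j 0 1) => //; first by ring.
  rewrite EAi EAj (subr0_eq sij).
  by apply/rowP => l; rewrite !mxE; ring.
by rewrite oppr_eq0 oner_eq0.
Qed.

End AffineIndependence.

Section MongePoint.
Variables (R : realType) (d n : nat) (A : 'I_n -> 'rV[R]_d) (M N : 'rV[R]_d).

(** With three indices at hand, 2 a_i = (a_i + a_j) + (a_i + a_k) - (a_j + a_k)
    recovers each a_i = A_i - M from the edge sums, so edge sums along one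
    direction put three vertices on a line through M. *)
Lemma edge_sums_not_parallel (v : 'rV[R]_d) : (2 < n)%N ->
  affinely_independent A ->
  (forall i j, i != j -> exists s : R, (A i - M) + (A j - M) = s *: v) -> False.
Proof.
move=> n_gt2 indepA par.
pose i0 := Ordinal (ltn_trans (isT : 0 < 2)%N n_gt2).
pose i1 := Ordinal (ltn_trans (isT : 1 < 2)%N n_gt2).
pose i2 := Ordinal n_gt2.
have par_vertex (i j k : 'I_n) : i != j -> i != k -> j != k ->
    exists s : R, A i - M = s *: v.
  move=> /par[s Es] /par[t Et] /par[u Eu]; exists (2^-1 * (s + t - u)).
  rewrite -scalerA scalerBl scalerDl -Es -Et -Eu.
  by apply/rowP => l; rewrite !mxE; field.
have [s0 E0] := par_vertex i0 i1 i2 isT isT isT.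
have [s1 E1] := par_vertex i1 i0 i2 isT isT isT.
have [s2 E2] := par_vertex i2 i0 i1 isT isT isT.
have i012 : uniq [:: i0; i1; i2] by [].
by case: (affinely_independent_not_collinear indepA i012 E0 E1 E2).
Qed.

(** With n = d + 1 vertices this is the explicit position of the Monge point.
    Two common points of all the Monge lines would make the directions
    a_i + a_j of these lines parallel to each other. *)
Lemma monge_point_unique : (2 < n)%N -> affinely_independent A ->
  is_monge_point A M N -> N = M + (n - 2)%:R^-1 *: \sum_i (A i - M).
Proof.
move=> n_gt2 indepA mongeN; set N' := M + _.
apply/eqP; rewrite -subr_eq0; apply/negPn/negP => NN'_neq0.
apply: (@edge_sums_not_parallel (N - N') n_gt2 indepA) => i j neq_ij.
have [Mmid | Mmid] := eqVneq M (midpoint (A i) (A j)).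
  (* The edge has no Monge line here, but then a_i + a_j = 0. *)
  exists 0; rewrite scale0r {1 2}Mmid /midpoint.
  by apply/rowP => l; rewrite !mxE; field.
have [t Nt] := mongeN i j neq_ij Mmid.
have n2_neq0 : (n - 2)%:R != 0 :> R by rewrite pnatr_eq0 -lt0n subn_gt0.
(* The parameter t / 2 locates N along a_i + a_j from the ridge centroid, and
   1 / (n - 2) locates N'. *)
set s : R := t / 2 - (n - 2)%:R^-1.
have Ev : N - N' = s *: ((A i - M) + (A j - M)).
  rewrite Nt (centroid_ridge A M) // /N' /midpoint /s.
  by apply/rowP => l; rewrite !mxE; field.
have s_neq0 : s != 0.
  by apply: contraNneq NN'_neq0 => s0; rewrite Ev s0 scale0r.
by exists s^-1; rewrite Ev scalerA mulVf // scale1r.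
Qed.

End MongePoint.

Lemma homothety_sphere (R : realType) (d : nat) (nrm : 'rV[R]_d -> R)
    (C X : 'rV[R]_d) (k r : R) : is_norm nrm -> k != 0 ->
  homothety C k @` sphere nrm X r = sphere nrm (homothety C k X) (`|k| * r).
Proof.
move=> [_ nrmZ _ _] k_neq0; apply/seteqP; split=> [_ [Y <- <-]|Y].
  rewrite /sphere /= -nrmZ /homothety; congr nrm.
  by apply/rowP => l; rewrite !mxE; ring.
rewrite /sphere /= => nrmY; exists (homothety C k^-1 Y); last first.
  by rewrite /homothety; apply/rowP => l; rewrite !mxE; field.
have -> : homothety C k^-1 Y - X = k^-1 *: (Y - homothety C k X).
  by rewrite /homothety; apply/rowP => l; rewrite !mxE; field.
by rewrite nrmZ nrmY normfV mulKf ?normr_eq0.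
Qed.

Theorem theorem4p3 (R : realType) (d : nat) (hd : (2 <= d)%N)
    (nrm : 'rV[R]_d -> R) (hnrm : is_norm nrm)
    (A : 'I_d.+1 -> 'rV[R]_d) (hA : affinely_independent A)
    (M : 'rV[R]_d) (rho : R) (hM : is_circumcenter nrm A M rho)
    (hGM : centroid A predT != M)
    (N : 'rV[R]_d) (hN : is_monge_point A M N) :
  let G := centroid A predT in
  let F := M + d%:R^-1 *: \sum_(i < d.+1) (A i - M) in
  let r := rho / d%:R in
  [/\ line M G F,
      forall i, sphere nrm F r (centroid A (predC1 i)),
      forall i, sphere nrm F r (dividing_point N (A i) 1 (d%:R - 1)),
      sphere nrm F r = homothety G (- 1 / d%:R) @` sphere nrm M rho
    & G = dividing_point F M 1 d%:R /\
      F = dividing_point N M 1 (d%:R - 1)].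
Proof.
move=> G F r; have [_ nrmZ _ _] := hnrm; have [_ nrmA] := hM.
have d_gt0 : (0 < d)%N by apply: ltnW.
have d_neq0 : d%:R != 0 :> R by rewrite pnatr_eq0 -lt0n.
have d1_neq0 : d%:R + 1 != 0 :> R by rewrite natr1 pnatr_eq0.
have dB1_neq0 : d%:R - 1 != 0 :> R by rewrite subr_eq0 pnatr_eq1 gtn_eqF.
have absVd : `|d%:R^-1| = d%:R^-1 :> R by rewrite ger0_norm // invr_ge0 ler0n.
have EN := monge_point_unique _ hA hN.
have {EN} EN : N = M + (d%:R - 1)^-1 *: \sum_i (A i - M).
  by rewrite EN // subSS natrB.
have EG : G = M + (d%:R + 1)^-1 *: \sum_i (A i - M).
  by rewrite natr1; apply: centroid_simplex.
have sphereF (Y : 'rV[R]_d) (e : R) i : `|e| = d%:R^-1 ->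
    Y - F = e *: (A i - M) -> sphere nrm F r Y.
  by move=> abs_e EY; rewrite /sphere /= EY nrmZ nrmA abs_e mulrC.
have EFG : F = homothety G (- 1 / d%:R) M.
  rewrite /homothety EG /F; move: (\sum_i _) => S.
  by apply/rowP => l; rewrite !mxE; field; rewrite ?dB1_neq0 ?d1_neq0 d_neq0.
split.
- exists ((d%:R + 1) / d%:R); rewrite EG /F; move: (\sum_i _) => S.
  by apply/rowP => l; rewrite !mxE; field; rewrite ?dB1_neq0 ?d1_neq0 d_neq0.
- move=> i; apply: (sphereF _ (- d%:R^-1) i); first by rewrite normrN.
  rewrite (centroid_facet A M) // /F; move: (\sum_i _) => S.
  by apply/rowP => l; rewrite !mxE; field.
- move=> i; apply: (sphereF _ d%:R^-1 i) => //.
  rewrite /dividing_point [1 + _]addrC subrK EN /F; move: (\sum_i _) => S.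
  by apply/rowP => l; rewrite !mxE; field; rewrite ?dB1_neq0 ?d1_neq0 d_neq0.
- rewrite homothety_sphere //; last by rewrite mulN1r oppr_eq0 invr_eq0.
  by rewrite -EFG mulN1r normrN absVd mulrC.
- split.
    rewrite /dividing_point EG /F; move: (\sum_i _) => S.
    by apply/rowP => l; rewrite !mxE; field; rewrite d_neq0 addrC d1_neq0.
  rewrite /dividing_point [1 + _]addrC subrK EN /F; move: (\sum_i _) => S.
  by apply/rowP => l; rewrite !mxE; field; rewrite ?dB1_neq0 ?d1_neq0 d_neq0.
Qed.
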